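(* (Urysohn's Lemma for a-spaces.) Let $A$ and $B$ be disjoint closed subsets of an arithmetically normal space $(X,\zeta_X)$, and let $\alpha,\beta\in\mathbb{R}$ with $\alpha\leq\beta$. Suppose that: (1) for all $x\in X$ there is $\lambda\in[\alpha,\beta]$ such that $\operatorname{den}(\lambda)$ divides $\zeta_X(x)$; (2) for all $a\in A$, $\operatorname{den}(\alpha)$ divides $\zeta_X(a)$; (3) for all $b\in B$, $\operatorname{den}(\beta)$ divides $\zeta_X(b)$. Then there exists an a-map $f\colon X\to[\alpha,\beta]$ such that $f(x)=\alpha$ for all $x\in A$ and $f(x)=\beta$ for all $x\in B$.
   Context: $\mathbb{N}=\{0,1,2,\dots\}$ is ordered by divisibility ($0$ is the top element) and carries the upper topology of this order: the sets $\{m\in\mathbb{N}\mid m \text{ divides } n\}$, $n\in\mathbb{N}$, form a subbasis for the closed sets. An a-space $(X,\zeta)$ is a topological space $X$ with a continuous function $\zeta\colon X\to\mathbb{N}$ (its denominator function). An a-map $f\colon (X,\zeta)\to(X',\zeta')$ is a continuous map such that $\zeta'(f(x))$ divides $\zeta(x)$ for all $x\in X$. For $p/q\in\mathbb{Q}$ with $p\in\mathbb{Z}$, $q\geq 1$ coprime, $\operatorname{den}(p/q)=q$; for $r\in\mathbb{R}\setminus\mathbb{Q}$, $\operatorname{den}(r)=0$. Subsets of $\mathbb{R}$, such as $[\alpha,\beta]$, are a-spaces with the Euclidean topology and the restriction of $\operatorname{den}$. An arithmetically normal space is an a-space $(X,\zeta)$ with $X$ compact and such that for any two distinct points $x,y\in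 X$ there are disjoint open neighbourhoods $U$ of $x$ and $V$ of $y$ with $\zeta(z)=0$ for every $z\in X\setminus(U\cup V)$. *)

(* Defs.v *)
From HB Require Import structures.
From mathcomp Require Import all_boot all_order all_algebra archimedean.
From mathcomp Require Import finmap all_classical all_reals.
From mathcomp Require Import topology normedtype.

Set Implicit Arguments.
Unset Strict Implicit.
Unset Printing Implicit Defensive.

Import Order.TTheory GRing.Theory Num.Theory.
Import numFieldNormedType.Exports.

Local Open Scope classical_set_scope.
Local Open Scope ring_scope.

(* The library already puts the discrete topology on [nat]; the upper topology
   of divisibility therefore lives on an alias. *)
Definition dvd_nat : Type := nat.

HB.instance Definition _ := Choice.on dvd_nat.
HB.instance Definition _ := @isSubBaseTopological.Build dvd_nat
  nat setT (fun n => ~` [set m : dvd_nat | (m %| n)%N]).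

Lemma dvd_natE : @open dvd_nat =
  [set \bigcup_(O in D) O | D in
     subset^~ (finI_from setT (fun n => ~` [set m : dvd_nat | (m %| n)%N]))].
Proof. by []. Qed.

Lemma dvd_nat_continuous (T : topologicalType) (f : T -> dvd_nat) :
  continuous f <-> forall n : nat, closed [set x | (f x %| n)%N].
Proof.
split=> [/continuousP cf n | cf].
  rewrite -openC -[X in open X]/(f @^-1` (~` [set m : dvd_nat | (m %| n)%N])).
  apply: cf; rewrite dvd_natE.
  exists [set ~` [set m : dvd_nat | (m %| n)%N]]; last by rewrite bigcup_set1.
  move=> _ ->; exists ([fset n]%fset); first by move=> ? _; rewrite inE.
  by rewrite set_fset1 bigcap_set1.
apply/continuousP => U; rewrite dvd_natE => -[D DF <-].
rewrite preimage_bigcup; apply: bigcup_open => O /DF [N _ <-].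
rewrite preimage_bigcap openE => x Nx; apply: filter_bigI => n nN.
apply: open_nbhs_nbhs; split; last exact: Nx.
by rewrite preimage_setC openC; exact: cf.
Qed.

Record aSpace := ASpace {
  aspace_sort :> topologicalType;
  denominator : aspace_sort -> nat;
  denominator_continuous : continuous (denominator : aspace_sort -> dvd_nat)
}.

Definition a_map (X Y : aSpace) (f : X -> Y) : Prop :=
  continuous f /\ forall x, (denominator (f x) %| denominator x)%N.

(* [compact] is the covering property alone; the Hausdorff property follows
   from the second clause. *)
Definition arithmetically_normal (X : aSpace) : Prop :=
  compact [set: X] /\
  forall x y : X, x <> y -> exists U V : set X,
    [/\ open U, open V, U x, V y & U `&` V = set0] /\
    forall z, ~ (U `|` V) z -> denominator z = 0%N.

Section den.
Variable R : realType.

Definition den (r : R) : nat :=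
  if pselect (exists q : rat, r = ratr q) is left rat_r
  then `|denq (projT1 (cid rat_r))|%N else 0%N.

Lemma den_ratr (q : rat) : den (ratr q) = `|denq q|%N.
Proof.
rewrite /den; case: pselect => [e|[]]; last by exists q.
by case: cid => q' /= /fmorph_inj ->.
Qed.

Lemma den_irrational (r : R) : irrational r -> den r = 0%N.
Proof.
by move=> irr; rewrite /den; case: pselect => // -[q rq]; case: irr; exists q.
Qed.

Lemma den_dvdP (r : R) (n : nat) : (0 < n)%N ->
  (den r %| n)%N <-> exists m : int, r * n%:R = m%:~R.
Proof.
move=> n_gt0; have nR0 : n%:R != 0 :> R by rewrite pnatr_eq0 -lt0n.
split.
  case: (pselect (rational r)) => [[q _ <-]|/den_irrational ->]; last first.
    by rewrite dvd0n => /eqP n0; rewrite n0 in n_gt0.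
  rewrite den_ratr => /dvdnP[k ->]; exists (numq q * k%:Z).
  have -> : ratr q = (numq q)%:~R / (denq q)%:~R :> R by [].
  rewrite natrM intrM -[(_ `|denq q|%N)]/(`|denq q|%N%:~R) absz_denq.
  by rewrite mulrCA mulrC divfK ?intr_eq0 ?denq_eq0.
case=> m rn; have -> : r = ratr (m%:Q / n%:Q).
  by rewrite rmorphM fmorphV !rmorph_int -rn pmulrn mulfK.
have denq_dvd (d : int) : d != 0 -> (`|denq (m%:Q / d%:Q)| %| `|d|)%N.
  by case: divqP => [|k q _ _]; rewrite ?eqxx // abszM dvdn_mull.
by rewrite den_ratr (denq_dvd n%:Z) // eqz_nat -lt0n.
Qed.

Lemma den_continuous : continuous (den : R -> dvd_nat).
Proof.
apply/dvd_nat_continuous => -[|n].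
  rewrite [X in closed X](_ : _ = setT) ?predeqE => [|r]; first exact: closedT.
  by split=> // _ /=; exact: dvdn0.
rewrite -openC openE => r /= rn.
pose c : R := r * n.+1%:R; pose k := Num.floor c.
have kc : k%:~R < c.
  rewrite lt_neqAle floor_le andbT; apply/eqP => kc; apply: rn.
  by apply/den_dvdP => //; exists k.
have n0 : 0 < n.+1%:R :> R by rewrite ltr0n.
have : r \in `](k%:~R / n.+1%:R), ((k + 1)%:~R / n.+1%:R)[.
  by rewrite in_itv /= ltr_pdivrMr // kc ltr_pdivlMr // floorD1_gt.
move=> /near_in_itvoo; apply: filterS => z.
rewrite in_itv /= ltr_pdivrMr // ltr_pdivlMr // => /andP[kz zk].
move/den_dvdP => /(_ isT)[m zm]; move: kz zk; rewrite zm !ltr_int.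
by rewrite ltzD1 => km; rewrite leNgt km.
Qed.

Lemma den_set_continuous (A : set R) :
  continuous ((fun x : A => den (set_val x)) : A -> dvd_nat).
Proof.
move=> x; apply: continuous_comp; last exact: den_continuous.
exact: initial_continuous.
Qed.

(* [set_type A] carries the initial topology of its inclusion into [R]. *)
Definition real_aspace (A : set R) : aSpace := ASpace (@den_set_continuous A).

End den.

(* Main.v *)
Require Import Defs.
From mathcomp Require Import all_boot all_order all_algebra.
From mathcomp Require Import all_classical all_reals topology normedtype.
From mathcomp Require Import lra.

Import Order.TTheory GRing.Theory Num.Theory.
Import numFieldNormedType.Exports.

Local Open Scope classical_set_scope.
Local Open Scope ring_scope.

(** Why the theorem is true.

    As for the classical Urysohn lemma, [f] is assembled from a chain of
    nested sets indexed by real levels.  A [cut] at level [r] is an open set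
    on which [f <= r] inside a closed set outside which [f >= r].  The points
    between the two will receive the value [r], so [den r] must divide their
    denominator.

    The arithmetic enters through the relation [step p q]: besides the usual
    nesting, every point in the band between the cuts [p] and [q] must have an
    admissible value, i.e. one whose denominator divides that of the point, in
    the interval between the two levels.  The crux is that steps can be
    halved ([interpolation]).  Call a point of the band low if it has no
    admissible value above the midpoint, high if it has none below.  A positive
    [n] with no multiple of [1/n] in a nondegenerate interval is bounded, so
    the points without admissible value in a half form a finite union of sets
    {x | zeta(x) divides n}, which are closed by continuity of zeta; and no
    point is both low and high, because the original step offered it some
    value.  Arithmetic normality, lifted from points to closed sets by
    compactness ([normal_separated]), separates the low side from the high
    side up to points of denominator 0, which tolerate any value; this gives
    the new cut.

    Iterating from the step between ([set0], [A]) at level [alpha] and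
    ([~` B], [setT]) at level [beta] gives a chain with arbitrarily small
    gaps, and f(x) is the infimum of the levels of the cuts containing [x].
    Continuity is the classical argument.  For the denominators: a point
    outside [A] lies in arbitrarily thin bands, hence f(x) is a limit of
    admissible values for x; the set of those is closed, because [den] is
    continuous, so f(x) is admissible. *)

(** * Separation of closed sets *)

(** Otherwise the complements in [K] of the sets satisfying [P] generate a
    proper filter; a neighbourhood satisfying [P] of one of its cluster points
    contradicts clustering. *)
Lemma compact_ind (T : topologicalType) (P : set T -> Prop) (K : set T) :
  P set0 -> (forall A B, A `<=` B -> P B -> P A) ->
  (forall A B, P A -> P B -> P (A `|` B)) ->
  (forall x, K x -> exists2 U, nbhs x U & P U) ->
  compact K -> P K.
Proof.
move=> P0 PS PU Ploc cK; apply: contrapT => nPK.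
pose F : set_system T := [set S | exists2 C, P C & K `\` C `<=` S].
have FF : ProperFilter F.
  split.
    move=> [C PC KC]; apply: nPK; apply: PS PC => x Kx.
    by apply: contrapT => nCx; exact: (KC x).
  split.
  - by exists set0.
  - move=> S1 S2 [C1 PC1 s1] [C2 PC2 s2]; exists (C1 `|` C2); first exact: PU.
    by move=> x [Kx /not_orP[n1 n2]]; split; [apply: s1|apply: s2].
  - by move=> S1 S2 S12 [C PC sC]; exists C => // x /sC /S12.
have FK : F K by exists set0 => // x [].
have [x [Kx clx]] := cK F FF FK.
have [U xU PU1] := Ploc x Kx.
have [|y [[_ nUy] Uy]] := clx (K `\` U) U _ xU; first by exists U.
exact: nUy.
Qed.

(** The separation that arithmetic normality provides for pairs of points. *)
Definition separated {X : aSpace} (A B : set X) : Prop :=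
  exists U V : set X,
    [/\ open U, open V, A `<=` U, B `<=` V & U `&` V = set0] /\
    forall z, ~ (U `|` V) z -> denominator z = 0%N.

Lemma separated_sym (X : aSpace) (A B : set X) : separated A B -> separated B A.
Proof.
move=> [U [V [[oU oV AU BV UV] Z]]]; exists V, U; split.
  by split=> //; rewrite setIC.
by rewrite setUC.
Qed.

(** The exceptional set stays inside {zeta = 0} when separations are combined:
    outside (U1 `|` U2) `|` (V1 `&` V2) a point misses one of the V's, hence
    the whole corresponding pair. *)
Lemma separated_compactl (X : aSpace) (K B : set X) : compact K ->
  (forall x, K x -> separated [set x] B) -> separated K B.
Proof.
move=> cK loc; move: cK; apply: (@compact_ind _ (fun K => separated K B)).
- exists set0, setT; split; last by move=> z []; right.
  by split=> //; [exact: open0|exact: openT|rewrite set0I].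
- move=> A A' AA' [U [V [[oU oV A'U BV UV] Z]]]; exists U, V; split=> //.
  by split=> // x /AA' /A'U.
- move=> A A' [U [V [[oU oV AU BV UV] Z]]] [U' [V' [[oU' oV' AU' BV' UV'] Z']]].
  exists (U `|` U'), (V `&` V'); split; first split.
  + exact: openU.
  + exact: openI.
  + by move=> x [/AU|/AU']; [left|right].
  + by move=> x Bx; split; [exact: BV|exact: BV'].
  + apply/disjoints_subset => x [Ux|U'x] [Vx V'x].
      by have : (U `&` V) x by []; rewrite UV.
    by have : (U' `&` V') x by []; rewrite UV'.
  + move=> z /not_orP[/not_orP[nU nU']] /not_andP[nV|nV'].
      by apply: Z => -[].
    by apply: Z' => -[].
- move=> x /loc[U [V [[oU oV xU BV UV] Z]]].
  exists U; last by exists U, V; split=> //; split.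
  by apply: open_nbhs_nbhs; split=> //; exact: (xU x erefl).
Qed.

Lemma normal_separated (X : aSpace) (A B : set X) :
  arithmetically_normal X -> closed A -> closed B -> A `&` B = set0 ->
  separated A B.
Proof.
move=> [cX sX] cA cB AB.
have cpt (C : set X) : closed C -> compact C.
  by move=> cC; apply: (@subclosed_compact _ C setT cC cX); exact: subsetT.
apply: separated_compactl (cpt _ cA) _ => x Ax.
apply/separated_sym/separated_compactl; first exact: cpt.
move=> y By; have xy : y <> x.
  by move=> yx; have : (A `&` B) x; [split=> //; rewrite -yx | rewrite AB].
have [U [V [[oU oV Uy Vx UV] Z]]] := sX y x xy.
by exists U, V; split=> //; split=> // z ->.
Qed.

(** * Values available to a given denominator *)

Definition realizable {R : realType} (a b : R) (n : nat) : Prop :=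
  exists2 r : R, r \in `[a, b] & (den r %| n)%N.

Lemma realizable_dvd (R : realType) (a b : R) (m n : nat) :
  (m %| n)%N -> realizable a b m -> realizable a b n.
Proof. by move=> mn [r rab rm]; exists r => //; exact: dvdn_trans mn. Qed.

(** Once [n * (b - a) >= 1], the largest multiple of [1/n] not exceeding [b]
    is at least [a]; and the denominator 0 accepts every value. *)
Lemma realizable_large (R : realType) (a b : R) : a < b ->
  exists N : nat, forall n, ~ realizable a b n -> (n < N)%N.
Proof.
move=> ab; have ba : 0 < b - a by rewrite subr_gt0.
exists (Num.truncn (b - a)^-1).+1 => n; apply: contra_notT; rewrite -leqNgt => Nn.
have n0 : (0 < n)%N by exact: leq_trans Nn.
have nR : 0 < n%:R :> R by rewrite ltr0n.
have nba : 1 <= n%:R * (b - a).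
  rewrite -ler_pdivrMr// div1r; apply/ltW/(lt_le_trans (truncnS_gt _)).
  by rewrite ler_nat.
(* The largest multiple of 1/n that is at most b. *)
exists ((Num.floor (b * n%:R))%:~R / n%:R); last first.
  by apply/den_dvdP => //; exists (Num.floor (b * n%:R)); rewrite divfK// gt_eqF.
have := floor_le (b * n%:R); have := floorD1_gt (b * n%:R).
rewrite intrD in_itv /= ler_pdivlMr// ler_pdivrMr// => h1 h2; rewrite h2 andbT.
by move: nba h1; rewrite mulrBr (mulrC n%:R b) (mulrC n%:R a); lra.
Qed.

(** Unrealizable numbers are bounded and closed under taking divisors, so the
    set is a finite union of sets {x | zeta(x) divides n}.  Nondegeneracy is
    essential: for [a = b] of denominator 2, points whose denominators are
    distinct odd primes may converge to a point of denominator 0. *)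
Lemma closed_unrealizable (X : aSpace) (R : realType) (a b : R) : a < b ->
  closed [set x : X | ~ realizable a b (denominator x)].
Proof.
move=> /realizable_large[N hN].
have dvd_closed n := (dvd_nat_continuous _).1 (@denominator_continuous X) n.
rewrite (_ : mkset _ =
  \bigcup_(n in `I_N) [set x | ~ realizable a b n /\ (denominator x %| n)%N]).
  apply: closed_bigcup => // n _.
  have [rn|nrn] := pselect (realizable a b n).
    rewrite (_ : mkset _ = set0) ?predeqE//; first exact: closed0.
    by move=> x; split=> // -[].
  rewrite (_ : mkset _ = [set x | (denominator x %| n)%N]); first exact: dvd_closed.
  by apply/seteqP; split=> x /= // -[].
apply/seteqP; split=> x /=.
  by move=> nr; exists (denominator x) => //; exact: hN.
by move=> [n _ /= [nr xn]]; apply: contra_not nr; exact: realizable_dvd.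
Qed.

(** * Cuts and their interpolation *)

Record cut (R : realType) (X : aSpace) := Cut {
  level : R;
  inner : set X;
  outer : set X;
  inner_open : open inner;
  outer_closed : closed outer;
  inner_outer : inner `<=` outer;
  edge_den : forall x, outer x -> ~ inner x -> (den level %| denominator x)%N
}.
Arguments Cut {R X level inner outer}.
Arguments level {R X}.
Arguments inner {R X}.
Arguments outer {R X}.

Definition below {R : realType} {X : aSpace} (p q : cut R X) : Prop :=
  level p < level q /\ outer p `<=` inner q.

(** The second clause is what keeps the construction going: it guarantees that
    a point squeezed between the two cuts can still be given a value. *)
Definition step {R : realType} {X : aSpace} (p q : cut R X) : Prop :=
  below p q /\ forall x, outer q x -> ~ inner p x ->
    realizable (level p) (level q) (denominator x).

Lemma below_trans (R : realType) (X : aSpace) (p q s : cut R X) :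
  below p q -> below q s -> below p s.
Proof.
move=> [pq kpq] [qs kqs]; split; first exact: lt_trans qs.
by move=> x /kpq /inner_outer /kqs.
Qed.

(** The new cut has to contain [outer p] and the points [Lo] without
    admissible value in the upper half, and to avoid the complement of
    [inner q] and the points [Hi] without admissible value in the lower half.
    These two closed sets are disjoint: the boundary points of [p] and [q] can
    take the levels of [p] and [q], and [step p q] excludes the points that are
    both in [Lo] and in [Hi]. *)
Lemma interpolation (R : realType) (X : aSpace) (p q : cut R X) :
  arithmetically_normal X -> step p q ->
  exists m, [/\ step p m, step m q & level m = (level p + level q) / 2].
Proof.
move=> nX [[pq kpq] rpq]; set r := (level p + level q) / 2.
have pr : level p < r by rewrite /r; lra.
have rq : r < level q by rewrite /r; lra.
pose Lo : set X := [set x | ~ realizable r (level q) (denominator x)].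
pose Hi : set X := [set x | ~ realizable (level p) r (denominator x)].
have := @normal_separated X (outer p `|` (Lo `&` outer q))
  (~` inner q `|` (Hi `&` ~` inner p)) nX.
case.
- apply: closedU; first exact: outer_closed.
  by apply: closedI; [exact: closed_unrealizable|exact: outer_closed].
- apply: closedU; first exact/open_closedC/inner_open.
  by apply: closedI; [exact: closed_unrealizable|exact/open_closedC/inner_open].
- apply/disjoints_subset => x.
  move=> [Kp|[Px Kq]] [nUq|[Qx nUp]].
  + exact/nUq/kpq.
  + apply: Qx; exists (level p); last exact: edge_den.
    by rewrite in_itv /= lexx ltW.
  + apply: Px; exists (level q); last exact: edge_den.
    by rewrite in_itv /= lexx ltW.
  + have [l] := rpq x Kq nUp; rewrite in_itv /= => /andP[pl lq] lx.
    have [lr|rl] := leP l r.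
      by apply: Qx; exists l; rewrite // in_itv /= pl.
    by apply: Px; exists l; rewrite // in_itv /= lq ltW.
move=> W [V [[oW oV AW BV WV] Z]].
have sub : W `<=` ~` V by apply/disjoints_subset.
have edge x : (~` V) x -> ~ W x -> (den r %| denominator x)%N.
  by move=> nV nW; rewrite Z ?dvdn0// => -[].
exists (Cut oW (open_closedC oV) sub edge); split=> //=; split=> /=.
- by split=> //= x Kx; apply: AW; left.
- move=> x nV nUp; apply: contrapT => nr.
  by apply: nV; apply: BV; right.
- split=> //= x nV; apply: contrapT => nU.
  by apply: nV; apply: BV; left.
- move=> x Kq nW; apply: contrapT => nr.
  by apply: nW; apply: AW; right.
Qed.

(** * Dyadic refinement *)

(** [g n] lists the cuts of the n-th subdivision, for indices from 0 to [2 ^ n];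
    even indices repeat the previous subdivision. *)
Lemma dyadic_chain (R : realType) (X : aSpace) (p0 p1 : cut R X) :
  arithmetically_normal X -> step p0 p1 ->
  exists g : nat -> nat -> cut R X,
    [/\ forall n, g n 0 = p0, forall n, g n (2 ^ n)%N = p1,
        forall n j, g n.+1 j.*2 = g n j &
        forall n j, (j < 2 ^ n)%N -> step (g n j) (g n j.+1) /\
          level (g n j.+1) - level (g n j) = (level p1 - level p0) / 2 ^+ n].
Proof.
move=> nX s01.
have /choice[mid midP] (pq : cut R X * cut R X) : exists m,
    step pq.1 pq.2 -> [/\ step pq.1 m, step m pq.2 &
      level m = (level pq.1 + level pq.2) / 2].
  have [/(interpolation _ _ _ _ nX)[m hm]|ns] := pselect (step pq.1 pq.2).
    by exists m.
  by exists pq.1.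
pose g := fix g n j := if n is n'.+1
  then if odd j then mid (g n' j./2, g n' j./2.+1) else g n' j./2
  else if j is 0 then p0 else p1.
have gS n j : g n.+1 j.*2 = g n j by rewrite /= odd_double doubleK.
have gSm n j : g n.+1 j.*2.+1 = mid (g n j, g n j.+1).
  by rewrite /= odd_double /= uphalf_double.
exists g; split=> //.
- by elim=> // n IH; rewrite -[0%N]/(0.*2) gS.
- by elim=> // n IH; rewrite expnS mul2n gS.
elim=> [|n IH] j.
  by case: j => // _; split; rewrite ?expr0 ?divr1.
rewrite expnS mul2n -(odd_double_half j); move: (odd j) j./2 => b k jn.
have kn : (k < 2 ^ n)%N.
  by rewrite -ltn_double; apply: leq_ltn_trans jn; exact: leq_addl.
have [st gap] := IH _ kn; have [s1 s2 lm] := midP (_, _) st.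
have gap' : (level p1 - level p0) / 2 ^+ n.+1 =
    (level (g n k.+1) - level (g n k)) / 2.
  by rewrite gap exprS invfM mulrA mulrAC.
case: b {jn}; rewrite ?add0n ?add1n.
  by rewrite -doubleS !gS gSm; split=> //; rewrite gap' lm /=; lra.
by rewrite gS gSm; split=> //; rewrite gap' lm /=; lra.
Qed.

(** All that is needed of the subdivisions: a chain of cuts in which every
    property that switches on between the two ends does so across a step with
    an arbitrarily small gap. *)
Lemma fine_chain (R : realType) (X : aSpace) (p0 p1 : cut R X) :
  arithmetically_normal X -> step p0 p1 ->
  exists D : set (cut R X),
    [/\ D p0, D p1,
        forall p q, D p -> D q -> [\/ p = q, below p q | below q p] &
        forall (e : R) (P : cut R X -> Prop), 0 < e -> ~ P p0 -> P p1 ->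
          exists p q,
            [/\ D p, D q, step p q, level q < level p + e & ~ P p /\ P q]].
Proof.
move=> nX s01; have [g [g0 g1 gS gP]] := @dyadic_chain R X p0 p1 nX s01.
exists [set p | exists n j, (j <= 2 ^ n)%N /\ p = g n j]; split.
- by exists 0, 0.
- by exists 0, 1%N; rewrite -[1%N]/(2 ^ 0)%N g1.
(* Two cuts become comparable in a common subdivision. *)
- have lift m n j : g n j = g (m + n)%N (j * 2 ^ m)%N.
    elim: m => [|m IH]; first by rewrite muln1.
    by rewrite addSn expnS mulnCA mul2n gS.
  have mono n i j : (i < j)%N -> (j <= 2 ^ n)%N -> below (g n i) (g n j).
    elim: j => // j IH; rewrite ltnS leq_eqVlt => /predU1P[->|ij] jn.
      by have [[]] := gP _ _ jn.
    apply: below_trans (IH ij (ltnW jn)) _.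
    by have [[]] := gP _ _ jn.
  move=> _ _ [n [i [iN ->]]] [m [j [jM ->]]].
  rewrite (lift m n i) (lift n m j) addnC.
  have iN' : (i * 2 ^ m <= 2 ^ (n + m))%N by rewrite expnD leq_mul2r iN orbT.
  have jM' : (j * 2 ^ n <= 2 ^ (n + m))%N.
    by rewrite addnC expnD leq_mul2r jM orbT.
  have [ij|ji|->] := ltngtP (i * 2 ^ m)%N (j * 2 ^ n)%N.
  + by constructor 2; exact: mono.
  + by constructor 3; exact: mono.
  + by constructor 1.
- move=> e P e0 nP0 P1.
  pose n := (Num.truncn ((level p1 - level p0) / e)).+1.
  have small : (level p1 - level p0) / 2 ^+ n < e.
    rewrite ltr_pdivrMr ?exprn_gt0// mulrC -ltr_pdivrMr//.
    apply: lt_trans (truncnS_gt _) _.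
    by rewrite -natrX ltr_nat; exact: ltn_expl.
  (* The step ends at the first cut of the subdivision that satisfies [P]. *)
  have ex : exists j, `[< P (g n j) >].
    by exists (2 ^ n)%N; apply/asboolP; rewrite g1.
  have [[|j]] := ex_minnP ex; move=> /asboolP Pj jmin; first by rewrite g0 in Pj.
  have jn : (j < 2 ^ n)%N by apply: jmin; apply/asboolP; rewrite g1.
  have [st gap] := gP _ _ jn.
  exists (g n j), (g n j.+1); split=> //.
  + by exists n, j; rewrite ltnW.
  + by exists n, j.+1.
  + by rewrite -ltrBlDl gap.
  + by split=> // Pj'; have := jmin j; rewrite ltnn => /(_ (asboolT Pj')).
Qed.

(** * The function defined by a chain of cuts *)

(** The infimum of the levels of the cuts containing x is pinned down by the
    chain: [level p] bounds f(x) from above for [x] in [outer p] and from below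
    for [x] outside [inner p].  Both the continuity and the divisibility follow
    from these two bounds and from the fineness of the chain. *)
Lemma step_function (R : realType) (X : aSpace) (p0 p1 : cut R X) :
  arithmetically_normal X -> step p0 p1 ->
  inner p0 = set0 -> outer p1 = setT ->
  exists f : X -> R,
    [/\ continuous f,
        forall x, (den (f x) %| denominator x)%N,
        forall x, f x \in `[level p0, level p1],
        forall x, outer p0 x -> f x = level p0 &
        forall x, ~ inner p1 x -> f x = level p1].
Proof.
move=> nX s01 p0_0 p1_T.
have [D [D0 D1 Dtot Dfine]] := @fine_chain R X p0 p1 nX s01.
pose S (x : X) := [set level p | p in [set p | D p /\ outer p x]].
have S1 x : S x (level p1) by exists p1 => //=; rewrite p1_T.
have lbS p x : D p -> ~ inner p x -> lbound (S x) (level p).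
  move=> Dp np _ [q [Dq qx] <-].
  by have [->//|[/ltW]|[_ /(_ _ qx)]] := Dtot p q Dp Dq.
pose f x := inf (S x).
have n0 x : ~ inner p0 x by rewrite p0_0.
have f_le p x : D p -> outer p x -> f x <= level p.
  by move=> Dp px; apply: ge_inf; [exists (level p0); exact: lbS|exists p].
have f_ge p x : D p -> ~ inner p x -> level p <= f x.
  move=> Dp px; apply: lb_le_inf; last exact: lbS.
  by exists (level p1).
have f0 x : level p0 <= f x by exact: f_ge.
have f1 x : f x <= level p1 by apply: f_le; rewrite ?p1_T.
have fA x : outer p0 x -> f x = level p0.
  by move=> px; apply/eqP; rewrite eq_le f0 f_le.
have fB x : ~ inner p1 x -> f x = level p1.
  by move=> px; apply/eqP; rewrite eq_le f1 f_ge.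
have dense a b : level p0 <= a -> a < b -> b <= level p1 ->
    exists p, [/\ D p, a < level p & level p < b].
  move=> a0 ab b1; have [|||p [q [_ Dq _ pq [/negP np aq]]]] :=
      Dfine (b - a) (fun p => a < level p).
  - by rewrite subr_gt0.
  - by apply/negP; rewrite -leNgt.
  - exact: lt_le_trans b1.
  by exists q; split=> //; rewrite -leNgt in np; lra.
exists f; split=> //; last by move=> x; rewrite in_itv /= f0 f1.
- move=> x; apply/cvgrPdist_lt => e e0; near=> y.
  rewrite ltr_distlC; apply/andP; split.
  + near: y; have [le|ge] := ltP (f x - e) (level p0).
      by apply: nearW => y; exact: lt_le_trans (f0 y).
    have [||p [Dp p_lo p_hi]] := dense (f x - e) (f x) ge => //.
      by rewrite ltrBlDr ltrDl.
    apply: (@filterS _ _ _ (~` outer p)) => [y py|].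
      by apply: lt_le_trans p_lo (f_ge _ _ Dp _) => /inner_outer.
    apply: open_nbhs_nbhs; split; first exact/closed_openC/outer_closed.
    by move=> /(f_le _ _ Dp); rewrite leNgt p_hi.
  + near: y; have [le|ge] := ltP (level p1) (f x + e).
      by apply: nearW => y; exact: le_lt_trans (f1 y) _.
    have [||p [Dp p_lo p_hi]] := dense (f x) (f x + e) (f0 x) => //.
      by rewrite ltrDl.
    apply: (@filterS _ _ _ (inner p)) => [y /inner_outer py|].
      by apply: le_lt_trans (f_le _ _ Dp py) p_hi.
    apply: open_nbhs_nbhs; split; first exact: inner_open.
    by apply: contrapT => /(f_ge _ _ Dp); rewrite leNgt p_lo.
- move=> x; have [px|npx] := pselect (outer p0 x).
    by rewrite fA//; apply: edge_den.
  (* The values admissible for [x] form a closed set; [f x] adheres to it. *)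
  have cl := (dvd_nat_continuous _).1 (@den_continuous R) (denominator x).
  apply: (cl (f x)) => N /nbhs_ballP[e /= e0 eN].
  have [|p [q [Dp Dq [_ pq] gap [np nq]]]] := Dfine e (fun p => outer p x) e0 npx.
    by rewrite p1_T.
  have np' : ~ inner p x by move=> /inner_outer.
  have [l + lx] := pq x nq np'; rewrite in_itv /= => /andP[pl lq].
  exists l; split=> //; apply: eN; rewrite /ball /= ltr_distlC.
  by have := f_le _ _ Dq nq; have := f_ge _ _ Dp np'; lra.
Unshelve. all: by end_near.
Qed.

Theorem theorem6p7 (R : realType) (X : aSpace) (A B : set X) (alpha beta : R)
  (X_normal : arithmetically_normal X)
  (A_closed : closed A) (B_closed : closed B) (AB_disjoint : A `&` B = set0)
  (alpha_le_beta : alpha <= beta)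
  (hX : forall x : X, exists2 lambda : R,
     lambda \in `[alpha, beta] & (den lambda %| denominator x)%N)
  (hA : forall a : X, A a -> (den alpha %| denominator a)%N)
  (hB : forall b : X, B b -> (den beta %| denominator b)%N) :
  exists f : X -> real_aspace `[alpha, beta],
    [/\ a_map f,
        forall x : X, A x -> set_val (f x) = alpha &
        forall x : X, B x -> set_val (f x) = beta].
Proof.
suff [f [cf df fab fA fB]] : exists f : X -> R,
    [/\ continuous f, forall x, (den (f x) %| denominator x)%N,
        forall x, f x \in `[alpha, beta],
        forall x, A x -> f x = alpha & forall x, B x -> f x = beta].
  exists (fun x => exist _ (f x) (mem_set (fab x))); split=> //.
  by split=> //; apply: continuous_comp_initial.
(* A step needs distinct levels, hence the separate case of equal ends. *)
move: alpha_le_beta; rewrite le_eqVlt => /predU1P[ab|ab].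
  exists (fun=> alpha); split=> //.
  - exact: cst_continuous.
  - move=> x; have [l] := hX x; rewrite -ab in_itv /= => /andP[al la].
    by have /eqP <- : l == alpha by rewrite eq_le la al.
  - by move=> x; rewrite -ab in_itv /= lexx.
have edgeA x : A x -> ~ set0 x -> (den alpha %| denominator x)%N by move=> /hA.
have edgeB x : setT x -> ~ (~` B) x -> (den beta %| denominator x)%N.
  by move=> _ /contrapT /hB.
pose p0 := Cut (@open0 X) A_closed (@sub0set _ A) edgeA.
pose p1 := Cut (closed_openC B_closed) (@closedT X) (@subsetT _ _) edgeB.
have [|//|//|f [cf df fab fA fB]] := @step_function R X p0 p1 X_normal.
  split; first by split=> //=; apply/disjoints_subset.
  by move=> x _ _; exact: hX.
by exists f; split=> // x Bx; exact: fB.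
Qed.
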